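(* Let $\mathcal{G}$ be a $\chi$-bounded class of graphs closed under taking induced subgraphs, and let $r$ be an integer. Then the class of graphs admitting a $\mathcal{G}$-bounded decomposition of rank at most $r$ is $\chi$-bounded.
   Context: All graphs are finite and simple. A class of graphs $\mathcal{G}$ is $\chi$-bounded if there is a function $f$ with $\chi(G)\le f(\omega(G))$ for all $G\in\mathcal{G}$, where $\chi$ is the chromatic number and $\omega$ the clique number. For a graph $H$ and a subset $W\subseteq V(H)$, the matrix of the cut $(W,V(H)\setminus W)$ is the $|W|\times|V(H)\setminus W|$ $0/1$ matrix $M$ indexed by $W$ and $V(H)\setminus W$ with $M_{uv}=1$ iff $uv\in E(H)$; the rank of the cut is the rank of $M$ over $\mathbb{F}_2$. A decomposition of a graph $G$ is a tree $T$ together with a map $\tau:V(G)\to V(T)$. Each edge $e$ of $T$ defines a cut of $G$ whose sides are the preimages under $\tau$ of the vertex sets of the two components of $T-e$; the rank of the decomposition is the maximum rank of these cuts over all edges of $T$. For a node $v$ of $T$, $G_{T,v}$ is the spanning subgraph of $G$ in which two vertices $u,u'$ are adjacent iff they are adjacent in $G$ and $v$ lies on the unique path in $T$ between $\tau(u)$ and $\tau(u')$ (possibly $v=\tau(u)$ or $v=\tau(u')$). The decomposition is $\mathcal{G}$-bounded if $G_{T,v}\in\mathcal{G}$ for every node $v$ of $T$. *)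

(* Defs.v *)
From HB Require Import structures.
From mathcomp Require Import all_boot all_order all_algebra.

Set Implicit Arguments.
Unset Strict Implicit.
Unset Printing Implicit Defensive.

Record sgraph := SGraph {
  vertex :> finType;
  adj : rel vertex;
  adj_sym : symmetric adj;
  adj_irrefl : irreflexive adj
}.

Section Graphs.
Variable G : sgraph.

Definition proper_coloring (k : nat) (c : {ffun G -> 'I_k}) : bool :=
  [forall x : G, forall y : G, adj x y ==> (c x != c y)].

Definition colorable (k : nat) : bool :=
  [exists c : {ffun G -> 'I_k}, proper_coloring c].

Lemma colorable_exists : exists k, colorable k.
Proof.
exists #|G|; apply/existsP; exists [ffun x => enum_rank x].
apply/forallP => x; apply/forallP => y; apply/implyP => xy.
rewrite !ffunE (inj_eq enum_rank_inj); apply/eqP => e.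
by rewrite e adj_irrefl in xy.
Qed.

Definition chromatic_number : nat := ex_minn colorable_exists.

Definition is_clique (A : {set G}) : bool :=
  [forall x in A, forall y in A, (x != y) ==> adj x y].

Definition clique_number : nat := \max_(A : {set G} | is_clique A) #|A|.

Section Induced.
Variable A : {set G}.

Definition induced_adj : rel {x : G | x \in A} :=
  [rel x y | adj (val x) (val y)].

Lemma induced_adj_sym : symmetric induced_adj.
Proof. by move=> x y; exact: adj_sym. Qed.

Lemma induced_adj_irrefl : irreflexive induced_adj.
Proof. by move=> x; exact: adj_irrefl. Qed.

Definition induced : sgraph := SGraph induced_adj_sym induced_adj_irrefl.
End Induced.

Definition cut_matrix (W : {set G}) : 'M['F_2]_(#|W|, #|~: W|) :=
  (\matrix_(i, j) (adj (enum_val i) (enum_val j))%:R)%R.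

Definition cut_rank (W : {set G}) : nat := (\rank (cut_matrix W))%MS.

End Graphs.

(* A class of graphs is a predicate on [sgraph]; invariance under isomorphism
   is not required. *)
Definition chi_bounded (C : sgraph -> Prop) : Prop :=
  exists f : nat -> nat,
    forall G : sgraph, C G -> chromatic_number G <= f (clique_number G).

Definition closed_under_induced (C : sgraph -> Prop) : Prop :=
  forall (G : sgraph) (A : {set G}), C G -> C (induced A).

Section Trees.
Variable T : sgraph.

Definition connected : Prop :=
  0 < #|T| /\ forall x y : T, connect (@adj T) x y.

(* The bound on the size excludes the degenerate closed walk x, y, x, which
   [ucycle] accepts. *)
Definition acyclic : Prop :=
  forall c : seq T, ucycle (@adj T) c -> size c <= 2.

Definition is_tree : Prop := connected /\ acyclic.

(* The path is x :: p. *)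
Definition is_path (x y : T) (p : seq T) : bool :=
  [&& path (@adj T) x p, last x p == y & uniq (x :: p)].

(* A path has at most #|T| vertices, so quantifying over tuples of length
   < #|T| loses nothing (see [on_pathP]). In a tree the path is unique. *)
Definition on_path (v x y : T) : bool :=
  [exists n : 'I_#|T|, exists p : n.-tuple T, is_path x y p && (v \in x :: p)].

Lemma on_pathP (v x y : T) :
  reflect (exists2 p : seq T, is_path x y p & v \in x :: p) (on_path v x y).
Proof.
apply: (iffP existsP) => [[n /existsP[p /andP[xyp vp]]]|[p xyp vp]].
  by exists p.
have lt_p : size p < #|T|.
  case/and3P: xyp => _ _ /card_uniqP /= up.
  by rewrite (leq_trans _ (max_card [in x :: p])) ?up.
exists (Ordinal lt_p); apply/existsP; exists (in_tuple p).
by rewrite xyp.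
Qed.

Lemma on_path_sym (v : T) : symmetric (on_path v).
Proof.
suff sub x y : on_path v x y -> on_path v y x.
  by move=> x y; apply/idP/idP; exact: sub.
case/on_pathP=> p /and3P[xp /eqP lp up] vp; apply/on_pathP.
have e : y :: rev (belast x p) = rev (x :: p).
  by rewrite (lastI x p) lp rev_rcons.
exists (rev (belast x p)); last by rewrite e mem_rev.
apply/and3P; split; last by rewrite e rev_uniq.
  by rewrite -lp rev_path (eq_path (e' := @adj T)) // => a b; exact: adj_sym.
case: p lp {xp up vp e} => [|a q] lp; first by rewrite -lp.
by rewrite (_ : belast x (a :: q) = x :: belast a q) // rev_cons last_rcons.
Qed.

Definition del_edge (x y : T) : rel T :=
  [rel u w | adj u w && ([set u; w] != [set x; y])].

Definition component_del_edge (x y : T) : {set T} :=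
  [set z | connect (del_edge x y) x z].

End Trees.

Record decomposition (G : sgraph) := Decomposition {
  dtree : sgraph;
  dtree_is_tree : is_tree dtree;
  dmap : G -> dtree
}.

Section Decompositions.
Variables (G : sgraph) (D : decomposition G).

(* Each edge of the tree is met in both orientations (x, y) and (y, x), which
   give the two sides of the same cut; the cut matrices are transposes. *)
Definition edge_cut (x y : dtree D) : {set G} :=
  @dmap G D @^-1: component_del_edge x y.

(* The rank is 0 if the tree has no edges. *)
Definition decomposition_rank : nat :=
  \max_(e : dtree D * dtree D | adj e.1 e.2) cut_rank (edge_cut e.1 e.2).

Section NodeGraph.
Variable v : dtree D.

Definition node_adj : rel G :=
  [rel u w | adj u w && on_path v (dmap D u) (dmap D w)].

Lemma node_adj_sym : symmetric node_adj.
Proof. by move=> u w; rewrite /node_adj /= adj_sym on_path_sym. Qed.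

Lemma node_adj_irrefl : irreflexive node_adj.
Proof. by move=> u; rewrite /node_adj /= adj_irrefl. Qed.

Definition node_graph : sgraph := SGraph node_adj_sym node_adj_irrefl.
End NodeGraph.

Definition bounded_decomposition (C : sgraph -> Prop) : Prop :=
  forall v : dtree D, C (node_graph v).

End Decompositions.

Definition admits_bounded_decomposition
    (C : sgraph -> Prop) (r : int) (G : sgraph) : Prop :=
  exists D : decomposition G,
    bounded_decomposition D C /\ (Posz (decomposition_rank D) <= r)%R.

(* Main.v *)
(* Root the tree, and bound the chromatic number of the graph induced on a set
   A of vertices by induction on its clique number. The home of a vertex w is
   the lowest node p such that w and its neighbours in A lie below p. If q is
   the child of p above w, then w has a neighbour in A outside the subtree of
   q. That neighbour is adjacent to every vertex of A below q with the same
   adjacencies outside as w, so these vertices, of the same type as w at q,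
   have smaller clique number.
   An edge between vertices with the same home p either belongs to the graph of
   the node p, or joins two vertices below the same child of p. The latter are
   separated by their type, one of 2^r, or by the induction hypothesis.
   For an edge between vertices with distinct homes, one home p lies strictly
   above the other home p' and has a vertex of A below p'. Such a p is
   determined by the type of that vertex at p', so for each p' there are at
   most 2^r of them, and the nodes can be coloured greedily from the root with
   2^r + 1 colours so that p and p' get distinct colours. *)
Require Import Defs.
From mathcomp Require Import all_boot all_order all_algebra.

Set Implicit Arguments.
Unset Strict Implicit.
Unset Printing Implicit Defensive.

(** * Colourings of relations *)

(** Working with arbitrary relations lets an edge set be split into pieces that are coloured
    separately. *)
Definition rel_colorable (V : finType) (n : nat) (e : rel V) : Prop :=
  exists c : V -> 'I_n, forall x y, e x y -> c x != c y.

Lemma rel_colorable_card (V K : finType) (n : nat) (e : rel V) (c : V -> K) :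
  #|K| <= n -> (forall x y, e x y -> c x != c y) -> rel_colorable n e.
Proof.
move=> leKn cP; exists (fun x => widen_ord leKn (enum_rank (c x))) => x y /cP.
apply: contra_neq => /(congr1 val) /= /val_inj; exact: enum_rank_inj.
Qed.

Lemma rel_colorableM (V : finType) (m n : nat) (e1 e2 e : rel V) :
  (forall x y, e x y -> e1 x y || e2 x y) ->
  rel_colorable m e1 -> rel_colorable n e2 -> rel_colorable (m * n) e.
Proof.
move=> sub [c1 c1P] [c2 c2P].
apply: (@rel_colorable_card _ ('I_m * 'I_n)%type _ _ (fun x => (c1 x, c2 x))).
  by rewrite card_prod !card_ord.
move=> x y /sub/orP[/c1P|/c2P]; apply: contra_neq; by case.
Qed.

(** No pair of [e] joins two blocks, so all blocks share the same [n] colours. *)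
Lemma rel_colorable_blocks (V K : finType) (key : V -> K) (n : nat)
    (e : rel V) :
  (forall x y, e x y -> key x = key y) ->
  (forall k, rel_colorable n [rel x y | (key x == k) && e x y]) ->
  rel_colorable n e.
Proof.
move=> eK /fin_all_exists[c cP]; exists (fun x => c (key x) x) => x y exy.
by rewrite -(eK _ _ exy); apply: cP; rewrite /= eqxx.
Qed.

(** On [A] the map [f] factors through [g]. The factor [s] takes values in an option type because
    [T1] has no default element. *)
Lemma leq_card_imset (T T1 T2 : finType) (f : T -> T1) (g : T -> T2)
    (A : {set T}) :
  {in A &, forall x y, g x = g y -> f x = f y} -> #|f @: A| <= #|g @: A|.
Proof.
move=> fg; pose s i := omap f [pick x in A | g x == i].
have inj : injective (@Some T1) by move=> x y [].
rewrite -(card_imset _ inj).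
apply: leq_trans (leq_imset_card s (g @: A)); apply/subset_leq_card/subsetP.
move=> _ /imsetP[_ /imsetP[x xA ->] ->]; apply/imsetP; exists (g x).
  exact: imset_f.
rewrite /s; case: pickP => [y /andP[yA /eqP gyx]|/(_ x)] /=.
  by rewrite (fg y x).
by rewrite xA eqxx.
Qed.

Lemma greedy_coloring (V : finType) (n : nat) (d : V -> nat)
    (B : V -> {set V}) :
  (forall x y, y \in B x -> d y < d x) -> (forall x, #|B x| <= n) ->
  exists c : V -> 'I_n.+1, forall x y, y \in B x -> c x != c y.
Proof.
move=> dB cardB.
suff [c cP] : exists c : V -> 'I_n.+1, forall x y,
    d x < (\max_z d z).+1 -> y \in B x -> c x != c y.
  by exists c => x y; apply: cP; rewrite ltnS leq_bigmax.
elim: (\max_z d z).+1 => [|m [c cP]]; first by exists (fun=> ord0).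
have fresh x : exists i, i \notin c @: B x.
  apply/existsP; rewrite -negb_forall; apply/negP => /forallP all_c.
  have : #|'I_n.+1| <= #|c @: B x| by apply/subset_leq_card/subsetP.
  by rewrite card_ord leqNgt ltnS (leq_trans (leq_imset_card _ _)).
have [g gP] := fin_all_exists fresh.
(* Only level [m] gets new colours; the members of [B x] lie on lower levels and keep theirs. *)
exists (fun x => if d x < m then c x else g x) => x y dx yB.
have lt_yx := dB _ _ yB; rewrite (leq_trans lt_yx) //.
case: ifP => [dxm|_]; first exact: cP.
by apply: contraNneq (gP x) => ->; apply: imset_f.
Qed.

Lemma rel_colorable_chromatic (G : sgraph) :
  rel_colorable (chromatic_number G) (@adj G).
Proof.
rewrite /chromatic_number; case: ex_minnP => k /existsP[c /forallP cP] _.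
by exists c => x y xy; have /forallP/(_ y)/implyP := cP x; apply.
Qed.

Lemma chromatic_number_le (G : sgraph) (n : nat) :
  rel_colorable n (@adj G) -> chromatic_number G <= n.
Proof.
case=> c cP; rewrite /chromatic_number; case: ex_minnP => k _; apply.
apply/existsP; exists [ffun x => c x].
apply/forallP => x; apply/forallP => y; apply/implyP => xy.
by rewrite !ffunE cP.
Qed.

(** * Types across a cut of small rank *)

(* Coordinates of the rows of the cut matrix in a row basis take at most
   [2 ^ r] values over [F_2]. *)
Lemma cut_rank_types (G : sgraph) (W : {set G}) (r : nat) :
  cut_rank W <= r ->
  exists t : G -> 'I_(2 ^ r), forall x y z,
    x \in W -> y \in W -> z \notin W -> t x = t y -> adj x z = adj y z.
Proof.
move=> le_r; pose M := cut_matrix W; pose k := (\rank M)%MS.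
have lek : #|{: 'rV['F_2]_k}| <= 2 ^ r.
  by rewrite card_mx card_Fp // mul1n leq_exp2l.
pose u (i : 'I_#|W|) : 'rV['F_2]_k := (row i M *m pinvmx (row_base M))%R.
have uM i : (u i *m row_base M = row i M)%R.
  by rewrite mulmxKpV // eq_row_base row_sub.
have pos : 0 < 2 ^ r by rewrite expn_gt0.
exists (fun x => if [pick i | enum_val i == x] is Some i
  then widen_ord lek (enum_rank (u i)) else Ordinal pos) => x y z xW yW zW.
have pickE v : v \in W ->
    exists2 i, [pick i : 'I_#|W| | enum_val i == v] = Some i & enum_val i = v.
  move=> vW; case: pickP => [i /eqP|/(_ (enum_rank_in vW v))].
    by exists i.
  by rewrite enum_rankK_in ?eqxx.
have [i -> <-] := pickE x xW; have [j -> <-] := pickE y yW.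
move=> /(congr1 val) /= /val_inj/enum_rank_inj eq_u.
have zC : z \in ~: W by rewrite inE.
have /rowP/(_ (enum_rank_in zC z)) : row i M = row j M by rewrite -!uM eq_u.
rewrite !mxE enum_rankK_in //.
by case: (adj _ z); case: (adj _ z).
Qed.

(** * Rooted trees *)

(** [par] is total and fixes the root, so the ancestors of a node are its iterates under [par]. *)
Record rooting (T : sgraph) := Rooting {
  root : T;
  par : T -> T;
  dep : T -> nat;
  par_root : par root = root;
  adj_par : forall x, x != root -> adj x (par x);
  dep_par : forall x, x != root -> dep x = (dep (par x)).+1;
  adj_parP : forall x y, adj x y ->
    (x != root /\ par x = y) \/ (y != root /\ par y = x)
}.

Lemma del_edge_sym (T : sgraph) (x y : T) : symmetric (del_edge x y).
Proof. by move=> u w; rewrite /del_edge /= adj_sym setUC. Qed.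

(** A simple path from [x] to [y] avoiding their edge has an inner vertex, so the edge closes it to
    a cycle on at least three vertices. *)
Lemma tree_bridge (T : sgraph) (x y : T) :
  acyclic T -> adj x y -> ~~ connect (del_edge x y) x y.
Proof.
move=> acy xy; apply/negP => /connectP[p0 p0P].
case/shortenP: p0P => p pP up _ lp.
have /acy : ucycle (@adj T) (x :: p).
  rewrite /ucycle up andbT /= rcons_path -lp adj_sym xy andbT.
  by apply: sub_path pP => u w /andP[].
case: p pP up lp => [|z [|]] //= => [_ _ e|].
  by rewrite e adj_irrefl in xy.
by rewrite andbT => /andP[_ /negP zP] _ e; case: zP; rewrite e.
Qed.

(** The root is arbitrary, the depth is the distance from it, and the parent of a node is the last
    but one vertex of a shortest walk to it. *)
Lemma tree_rooting (T : sgraph) : is_tree T -> inhabited (rooting T).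
Proof.
case=> -[/card_gt0P[rt _] conn] acy.
pose walk n (x : T) :=
  [exists t : n.-tuple T, path (@adj T) rt t && (last rt t == x)].
have walkP n x : reflect (exists p, [/\ path (@adj T) rt p, last rt p = x
    & size p = n]) (walk n x).
  apply: (iffP existsP) => [[t /andP[tP /eqP lt]]|[p [pP lp sp]]].
    by exists t; rewrite size_tuple.
  move/eqP in sp; exists (Tuple sp); rewrite /= pP; exact/eqP.
have ex_walk x : exists n, walk n x.
  have /connectP[p pP ->] := conn rt x.
  by exists (size p); apply/walkP; exists p.
pose d x := ex_minn (ex_walk x).
have step x : exists y, x != rt -> adj x y /\ d x = (d y).+1.
  case: (eqVneq x rt) => [_|xr]; first by exists x.
  rewrite {1}/d; case: ex_minnP => n /walkP[p []].
  case/lastP: p => [_ /= e|p y]; first by rewrite -e eqxx in xr.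
  rewrite last_rcons rcons_path size_rcons => /andP[pP ly] <- {x xr} <- min_n.
  exists (last rt p) => _; split; first by rewrite adj_sym.
  congr _.+1; apply/eqP; rewrite eqn_leq; apply/andP; split; rewrite /d.
    case: ex_minnP => m /walkP[q [qP lq <-]] _.
    rewrite -ltnS; apply: min_n; apply/walkP; exists (rcons q y).
    by rewrite rcons_path qP lq last_rcons size_rcons.
  by case: ex_minnP => m _; apply; apply/walkP; exists p.
have [g gP] := fin_all_exists step.
pose pr x := if x == rt then rt else g x.
have pr_root : pr rt = rt by rewrite /pr eqxx.
have prP x : x != rt -> adj x (pr x) /\ d x = (d (pr x)).+1.
  by move=> xr; rewrite /pr (negPf xr); apply: gP.
constructor.
apply: (@Rooting T rt pr d pr_root) => [x /prP[]|x /prP[]|x y xy] //.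
have [/andP[? /eqP ?]|nx] := boolP ((x != rt) && (pr x == y)); first by left.
have [/andP[? /eqP ?]|ny] := boolP ((y != rt) && (pr y == x)); first by right.
case/negP: (tree_bridge acy xy).
(* The parent edges alone connect everything to the root, so an edge which is
   not a parent edge cannot be a bridge. *)
have to_root z : connect (del_edge x y) z rt.
  move: {2}(d z) (leqnn (d z)) => n; elim: n z => [|n IHn] z dz;
    have [->|zr] := eqVneq z rt; rewrite ?connect0 //;
    have [zpz dE] := prP z zr; first by rewrite dE in dz.
  apply: connect_trans (IHn (pr z) _); last by rewrite -ltnS -dE.
  apply: connect1; rewrite /del_edge /= zpz /=; apply/negP => /eqP eqs.
  have : z \in [set x; y] by rewrite -eqs set21.
  have : pr z \in [set x; y] by rewrite -eqs set22.
  rewrite !inE => /orP[]/eqP pz /orP[]/eqP zE; subst z.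
  - by rewrite pz adj_irrefl in zpz.
  - by rewrite zr pz eqxx in ny.
  - by rewrite zr pz eqxx in nx.
  - by rewrite pz adj_irrefl in zpz.
apply: connect_trans (to_root x) _.
rewrite (sym_connect_sym (@del_edge_sym _ _ _)); exact: to_root.
Qed.

Definition anc (T : sgraph) (R : rooting T) (p x : T) : bool :=
  fconnect (par R) x p.

Lemma anc_refl (T : sgraph) (R : rooting T) (x : T) : anc R x x.
Proof. exact: connect0. Qed.

Lemma anc_trans (T : sgraph) (R : rooting T) (q p x : T) :
  anc R p q -> anc R q x -> anc R p x.
Proof. by move=> pq qx; apply: connect_trans qx pq. Qed.

Lemma anc_par (T : sgraph) (R : rooting T) (x : T) : anc R (par R x) x.
Proof. exact: fconnect1. Qed.

Lemma anc_case (T : sgraph) (R : rooting T) (p x : T) :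
  anc R p x -> p = x \/ (x != root R /\ anc R p (par R x)).
Proof.
move=> /iter_findex; case: (findex _ _ _) => [/= ->|n]; first by left.
rewrite iterSr; have [->|xr] := eqVneq x (root R).
  have e m : iter m (par R) (root R) = root R.
    by elim: m => //= m ->; rewrite par_root.
  by rewrite par_root e => ->; left.
by move=> <-; right; split=> //; apply: fconnect_iter.
Qed.

Lemma dep_ind (T : sgraph) (R : rooting T) (P : T -> Prop) :
  P (root R) -> (forall x, x != root R -> P (par R x) -> P x) ->
  forall x, P x.
Proof.
move=> P0 PS x; move: {2}(dep R x) (leqnn (dep R x)) => n.
elim: n x => [|n IHn] x dx; have [->//|xr] := eqVneq x (root R).
  by rewrite dep_par in dx.
by apply: PS => //; apply: IHn; rewrite dep_par in dx.
Qed.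

Lemma anc_dep (T : sgraph) (R : rooting T) (p x : T) :
  anc R p x -> p = x \/ dep R p < dep R x.
Proof.
elim/(dep_ind (R := R)): x => [|x xr IHx] /anc_case[->|[xr' px]]; try by left.
  by rewrite eqxx in xr'.
right; rewrite (dep_par xr) ltnS.
by case: (IHx px) => [->|/ltnW].
Qed.

Lemma anc_eq (T : sgraph) (R : rooting T) (p x : T) :
  anc R p x -> dep R x <= dep R p -> p = x.
Proof. by move=> /anc_dep[] // lt; rewrite leqNgt lt. Qed.

Lemma anc_anti (T : sgraph) (R : rooting T) (p x : T) :
  anc R p x -> anc R x p -> p = x.
Proof. by move=> px /anc_dep[->//|/ltnW]; apply: anc_eq. Qed.

Lemma anc_total (T : sgraph) (R : rooting T) (p q x : T) :
  anc R p x -> anc R q x -> anc R p q \/ anc R q p.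
Proof.
move=> /iter_findex <- /iter_findex <-.
set m := findex _ _ _; set n := findex _ _ _.
by case/orP: (leq_total m n) => /subnK <-; [right|left];
  rewrite iterD; apply: fconnect_iter.
Qed.

Lemma anc_root (T : sgraph) (R : rooting T) (x : T) : anc R (root R) x.
Proof.
elim/(dep_ind (R := R)): x => [|x _ IHx]; first exact: anc_refl.
exact: anc_trans IHx (anc_par R x).
Qed.

Lemma anc_child (T : sgraph) (R : rooting T) (p x : T) :
  anc R p x -> p != x -> exists q, [/\ q != root R, par R q = p & anc R q x].
Proof.
elim/(dep_ind (R := R)): x => [|x xr IHx] /anc_case[->|[xr' px]];
  rewrite ?eqxx //; first by rewrite eqxx in xr'.
move=> _; have [->|npx] := eqVneq p (par R x).
  by exists x; split=> //; apply: anc_refl.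
have [q [qr qp qx]] := IHx px npx.
by exists q; split=> //; apply: anc_trans qx (anc_par R x).
Qed.

Lemma child_uniq (T : sgraph) (R : rooting T) (q q' x : T) :
  q != root R -> q' != root R -> par R q = par R q' ->
  anc R q x -> anc R q' x -> q = q'.
Proof.
move=> qr qr' eq_par qx qx'.
have eq_dep : dep R q = dep R q' by rewrite (dep_par qr) eq_par -dep_par.
by case: (anc_total qx qx') => /anc_eq; rewrite eq_dep => /(_ (leqnn _)).
Qed.

(** The edge from [p] to its parent is the only one leaving the subtree of [p], so the cuts of the
    decomposition are given by subtrees. *)
Lemma component_anc (T : sgraph) (R : rooting T) (p : T) :
  p != root R -> component_del_edge p (par R p) = [set x | anc R p x].
Proof.
move=> pr; apply/setP => x; rewrite !inE; apply/idP/idP.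
  case/connectP => s sP ->.
  suff stay x0 : anc R p x0 -> path (del_edge p (par R p)) x0 s ->
      anc R p (last x0 s) by apply: stay sP; apply: anc_refl.
  elim: s x0 {sP} => //= y s IHs u pu /andP[/andP[uy nuy]]; apply: IHs.
  case: (adj_parP R uy) => -[_ e]; last first.
    by rewrite -e in pu; apply: anc_trans pu (anc_par R y).
  case: (anc_case pu) => [pE|[_]]; last by rewrite e.
  by rewrite -e -pE eqxx in nuy.
elim/(dep_ind (R := R)): x => [|x xr IHx] /anc_case[->|[xr' px]];
  rewrite ?connect0 //; first by rewrite eqxx in xr'.
have [->//|npx] := eqVneq x p.
apply: connect_trans (IHx px) (connect1 _).
rewrite /del_edge /= adj_sym adj_par //=; apply/negP => /eqP eqs.
have : x \in [set p; par R p] by rewrite -eqs set22.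
rewrite !inE (negPf npx) /= => /eqP xE.
have : anc R p x by apply: anc_trans px (anc_par R x).
rewrite xE => /(anc_anti (anc_par R p)) e.
by rewrite xE e eqxx in npx.
Qed.

(* A path leaves the subtree of [q] only through the parent of [q]. *)
Lemma anc_path (T : sgraph) (R : rooting T) (q x : T) (s : seq T) :
  q != root R -> path (@adj T) x s -> par R q \notin x :: s ->
  anc R q x -> anc R q (last x s).
Proof.
move=> qr; elim: s x => //= y s IHs x /andP[xy ys].
rewrite !inE !negb_or => /and3P[px py ps] qx.
apply: IHs => //; first by rewrite inE negb_or py.
case: (adj_parP R xy) => -[_ e]; last first.
  by rewrite -e in qx; apply: anc_trans qx (anc_par R y).
case: (anc_case qx) => [qE|[_]]; last by rewrite e.
by rewrite qE e eqxx in py.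
Qed.

(** A path that starts below [p] and misses [p] stays below the child of [p] under which it
    starts. *)
Lemma on_path_or_child (T : sgraph) (R : rooting T) (p x y : T) :
  connected T -> anc R p x -> anc R p y ->
  on_path p x y \/
  exists q, [/\ q != root R, par R q = p, anc R q x & anc R q y].
Proof.
move=> [_ conn] px py; have /connectP[s0 s0P lE] := conn x y; subst y.
case: (shortenP s0P) py => s sP us _ py.
have [ps|ps] := boolP (p \in x :: s).
  by left; apply/on_pathP; exists s; rewrite // /is_path sP us eqxx.
have [|q [qr qp qx]] := anc_child px.
  by apply: contraNneq ps => ->; apply: mem_head.
by right; exists q; split=> //; apply: anc_path; rewrite ?qp.
Qed.

(** The types come from the cut at the edge from [p] to its parent. Nothing lies outside the subtree
    of the root, so there a constant type will do. *)
Lemma cut_types (G : sgraph) (D : decomposition G) (R : rooting (dtree D))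
    (r : nat) (p : dtree D) :
  decomposition_rank D <= r ->
  exists t : G -> 'I_(2 ^ r), forall x y z,
    anc R p (dmap D x) -> anc R p (dmap D y) -> ~~ anc R p (dmap D z) ->
    t x = t y -> adj x z = adj y z.
Proof.
move=> le_r; have [->|pr] := eqVneq p (root R).
  have pos : 0 < 2 ^ r by rewrite expn_gt0.
  by exists (fun=> Ordinal pos) => x y z _ _; rewrite anc_root.
have /cut_rank_types[t tP] : cut_rank (edge_cut p (par R p)) <= r.
  apply: leq_trans le_r.
  apply: (@leq_bigmax_cond _ _ (fun e => cut_rank (edge_cut e.1 e.2))
    (p, par R p)).
  exact: adj_par.
by exists t => x y z px py pz; apply: tP;
  rewrite /edge_cut component_anc // !inE.
Qed.

(** * Homes *)
(** The last clause expresses lowest by ancestry rather than depth, so that two homes can be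
    compared directly. *)
Definition is_home (G : sgraph) (D : decomposition G) (R : rooting (dtree D))
    (A : {set G}) (w : G) (p : dtree D) : Prop :=
  [/\ anc R p (dmap D w),
      forall y, y \in A -> adj w y -> anc R p (dmap D y) &
      forall q, anc R q (dmap D w) ->
        (forall y, y \in A -> adj w y -> anc R q (dmap D y)) -> anc R q p].

(** The root is a candidate, and all candidates are ancestors of [dmap D w], hence form a chain; the
    deepest one is the home. *)
Lemma home_exists (G : sgraph) (D : decomposition G) (R : rooting (dtree D))
    (A : {set G}) (w : G) :
  exists p, is_home R A w p.
Proof.
pose P q := anc R q (dmap D w) &&
  [forall y, (y \in A) && adj w y ==> anc R q (dmap D y)].
have P0 : P (root R).
  by rewrite /P anc_root; apply/forallP => y; rewrite anc_root implybT.
case: (arg_maxnP (dep R) P0) => p /andP[pw /forallP pP] max_p.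
exists p; split=> // [y yA wy|q qw qP]; first by have := pP y; rewrite yA wy.
have /max_p le_qp : P q.
  by rewrite /P qw; apply/forallP => y; apply/implyP => /andP[]; apply: qP.
case: (anc_total qw pw) => // pq; by rewrite (anc_eq pq le_qp) anc_refl.
Qed.

Lemma homes_colorable (G : sgraph) (D : decomposition G)
    (R : rooting (dtree D)) (r : nat) (A : {set G}) (h : G -> dtree D)
    (t : dtree D -> G -> 'I_(2 ^ r)) :
  (forall p x y z, anc R p (dmap D x) -> anc R p (dmap D y) ->
    ~~ anc R p (dmap D z) -> t p x = t p y -> adj x z = adj y z) ->
  (forall w, is_home R A w (h w)) ->
  rel_colorable (2 ^ r).+1
    [rel x y | [&& x \in A, y \in A, adj x y & h x != h y]].
Proof.
move=> tP hP.
pose S p := [set x | [&& anc R p (dmap D x), anc R (h x) p & h x != p]].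
pose B p := h @: S p.
(* Neighbours of [y] below [p] are below [h x] because [p] is; by equality of types, those outside
   are neighbours of [x]. So [h x] is a candidate for the home of [y]. *)
have home_t p x y : x \in S p -> y \in S p -> t p x = t p y ->
    anc R (h x) (h y).
  rewrite !inE => /and3P[px hxp _] /and3P[py hyp _] txy.
  have [_ hxA _] := hP x; have [_ _] := hP y; apply.
    exact: anc_trans hxp py.
  move=> z zA yz; have [pz|pz] := boolP (anc R p (dmap D z)).
    exact: anc_trans hxp pz.
  by apply: hxA => //; rewrite (tP p x y z).
have cardB p : #|B p| <= 2 ^ r.
  rewrite -[X in _ <= X]card_ord.
  apply: leq_trans (leq_card_imset (g := t p) _) (max_card _).
  move=> x y xS yS txy; apply: (anc_anti (R := R)).
    exact: home_t txy.
  exact: home_t (esym txy).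
have [|c cP] := greedy_coloring (d := dep R) _ cardB.
  move=> x y /imsetP[z]; rewrite inE => /and3P[_ /anc_dep[->|lt] ne] -> //.
  by rewrite eqxx in ne.
exists (fun x => c (h x)) => x y /and4P[xA yA xy ne].
have [hx hxA _] := hP x; have [hy hyA _] := hP y.
(* Both homes are ancestors of [x], hence comparable, and the upper one belongs to [B] of the lower
   one. *)
case: (anc_total hx (hyA x xA _)) => [|hxy|hyx]; first by rewrite adj_sym.
  rewrite eq_sym; apply: cP; apply: imset_f; rewrite inE hxy ne.
  by rewrite hyA // adj_sym.
by apply: cP; apply: imset_f; rewrite inE hyx eq_sym ne hxA.
Qed.

(** * Induction on the clique number *)

Lemma clique_colorable (G : sgraph) (D : decomposition G) (r F : nat) :
  decomposition_rank D <= r ->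
  (forall v : dtree D, rel_colorable F (@node_adj G D v)) ->
  forall (k : nat) (A : {set G}),
  (forall K : {set G}, is_clique K -> K \subset A -> #|K| <= k) ->
  rel_colorable (((2 ^ r).+1 * (F * 2 ^ r)) ^ k)
    [rel x y | [&& x \in A, y \in A & adj x y]].
Proof.
move=> le_r colF; have [conn _] := dtree_is_tree D.
have [R] := tree_rooting (dtree_is_tree D).
have [t tP] := fin_all_exists (fun p => cut_types R p le_r).
elim=> [|k IHk] A cliqueA.
  (* A singleton is a clique, so [A] is empty and one colour suffices. *)
  have pos : 0 < 1 by [].
  exists (fun=> Ordinal pos) => x y /= /andP[xA _].
  suff : #|[set x]| <= 0 by rewrite cards1.
  apply: cliqueA; last by rewrite sub1set.
  apply/forall_inP => u /set1P->.
  by apply/forall_inP => v /set1P->; rewrite eqxx.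
have [h hP] := fin_all_exists (home_exists R A).
(* The default occurs when [x] is mapped to its home itself; [ok] says that [ch x] is a genuine
   child of the home. *)
pose ch x := odflt (h x)
  [pick q | [&& q != root R, par R q == h x & anc R q (dmap D x)]].
have chE x q : q != root R -> par R q = h x -> anc R q (dmap D x) -> ch x = q.
  move=> qr qh qx; rewrite /ch; case: pickP => [q' /and3P[qr' /eqP qh' qx']|].
    by apply: child_uniq qx' qx => //; rewrite qh qh'.
  by move/(_ q); rewrite qr qh eqxx qx.
pose ok x := [&& ch x != root R, par R (ch x) == h x & anc R (ch x) (dmap D x)].
pose e := [rel x y : G | [&& x \in A, y \in A & adj x y]].
(* The factors are, in order, for edges between distinct homes, edges of node graphs, edges between
   distinct types below a common child, and the edges left to the induction hypothesis. *)
rewrite expnS -!mulnA.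
apply: (rel_colorableM (e2 := [rel x y | e x y && (h x == h y)]))
  (homes_colorable tP hP) _ => [x y /= /and3P[-> -> ->]|]; first exact: orNb.
apply: (rel_colorableM (e1 := [rel x y | (h x == h y) && node_adj (h x) x y])
  (e2 := [rel x y | [&& e x y, ok x, ok y & ch x == ch y]])) => [x y| |].
- case/andP=> exy /eqP hxy; have /and3P[xA yA xy] := exy.
  have [hx _ _] := hP x; have [hy _ _] := hP y; rewrite -hxy in hy.
  rewrite /= -hxy eqxx xy /=.
  case: (on_path_or_child conn hx hy) => [op|[q [qr qp qx qy]]].
    by rewrite /node_adj /= xy op.
  have cx := chE x q qr qp qx.
  have cy := chE y q qr (etrans qp hxy) qy.
  by rewrite /ok cx cy qr qp -hxy !eqxx qx qy xA yA !orbT.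
- apply: (rel_colorable_blocks (key := h)) => [x y /andP[/eqP]//|p].
  have [c cP] := colF p; exists c => x y /= /andP[/eqP hx /andP[_]].
  by rewrite hx => /cP.
apply: (rel_colorableM
  (e1 := [rel x y | (ch x == ch y) && (t (ch x) x != t (ch y) y)])
  (e2 := [rel x y | [&& e x y, ok x, ok y
    & (ch x, t (ch x) x) == (ch y, t (ch y) y)]]))
  => [x y| |].
- case/and4P=> /and3P[xA yA xy] okx oky /eqP chxy.
  by rewrite /= xA yA xy okx oky chxy xpair_eqE !eqxx /= orNb.
- by exists (fun x => t (ch x) x) => x y /andP[_].
apply: (rel_colorable_blocks (key := fun x => (ch x, t (ch x) x)))
  => [x y /and4P[_ _ _ /eqP]//|[q i]].
pose X := [set x in A | ok x & (ch x, t (ch x) x) == (q, i)].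
have [|c cP] := IHk X.
  move=> K cK sKX; have [->|[w wK]] := set_0Vmem K; first by rewrite cards0.
  have /setIdP[wA /andP[/and3P[chr /eqP chh chw] /eqP[wq wt]]] :=
    subsetP sKX w wK.
  have [_ _ hw] := hP w.
  (* Otherwise [q] would be an ancestor of the home of [w], which is its own parent. Adding [y] to
     [K] will give a larger clique in [A]. *)
  have [y /and3P[yA wy ny]] :
      exists y, [&& y \in A, adj w y & ~~ anc R q (dmap D y)].
    apply/existsP; rewrite -[X in is_true X]negbK negb_exists.
    apply/negP => /forallP no.
    rewrite wq in chr chh chw.
    have qh : anc R q (h w).
      by apply: hw => // y yA wy; have := no y; rewrite yA wy /= negbK.
    have hq : anc R (h w) q by rewrite -chh; apply: anc_par.
    by have := adj_par chr; rewrite chh (anc_anti qh hq) adj_irrefl.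
  have yX x : x \in K -> adj x y.
    move=> xK; have /setIdP[xA /andP[/and3P[_ _ chx] /eqP[xq xt]]] :=
      subsetP sKX x xK.
    rewrite wq in chw wt; rewrite xq in chx xt.
    by rewrite (tP q x w y) // xt wt.
  have yK : y \notin K by apply/negP => /yX; rewrite adj_irrefl.
  have : #|y |: K| <= k.+1.
    apply: cliqueA.
      apply/forall_inP => u /setU1P[->|uK];
        apply/forall_inP => v /setU1P[->|vK].
      - by rewrite eqxx.
      - by rewrite adj_sym yX // implybT.
      - by rewrite yX // implybT.
      - by have /forall_inP/(_ u uK)/forall_inP/(_ v vK) := cK.
    rewrite subUset sub1set yA; apply/subsetP => x /(subsetP sKX).
    by rewrite inE => /andP[].
  by rewrite cardsU1 yK.
exists c => x y /andP[/eqP kx /and4P[/and3P[xA yA xy] okx oky /eqP kxy]].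
by apply: cP; rewrite /= !inE xA yA okx oky xy -kxy kx eqxx.
Qed.

Theorem theorem4 (C : sgraph -> Prop) (r : int) :
  chi_bounded C -> closed_under_induced C ->
  chi_bounded (admits_bounded_decomposition C r).
Proof.
(* [f] need not be monotone and node graphs may have clique number below [w], hence the maximum. *)
case=> f fP _; exists (fun w => let F := \max_(i < w.+1) f i in
  ((2 ^ absz r).+1 * (F * 2 ^ absz r)) ^ w) => G [D [bD rkD]] /=.
(* A negative [r] contradicts [rkD], so [absz r] is [r] here. *)
have rkD' : decomposition_rank D <= absz r by case: r rkD.
apply: chromatic_number_le.
have [||c cP] := @clique_colorable G D _
  (\max_(i < (clique_number G).+1) f i) rkD' _ (clique_number G) setT.
- move=> v; have [c cP] := rel_colorable_chromatic (node_graph v).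
  apply: (rel_colorable_card (c := c)) => //; rewrite card_ord.
  apply: leq_trans (fP _ (bD v)) _.
  (* A node graph is a spanning subgraph of [G], so its cliques are cliques of [G]. *)
  have le_w : clique_number (node_graph v) < (clique_number G).+1.
    rewrite ltnS; apply/bigmax_leqP => K cK.
    apply: (@leq_bigmax_cond _ (@is_clique G) (fun A => #|A|) K).
    apply/forall_inP => x xK; apply/forall_inP => y yK; apply/implyP => nxy.
    move/forall_inP: cK => /(_ x xK)/forall_inP/(_ y yK)/implyP/(_ nxy).
    by case/andP.
  exact: (leq_bigmax (Ordinal le_w)).
- move=> K cK _.
  exact: (@leq_bigmax_cond _ (@is_clique G) (fun A => #|A|) K).
by exists c => x y xy; apply: cP; rewrite /= !inE.
Qed.
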